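(* Let $T$ be a rooted directed tree and let $U$ be the underlying undirected tree of $T$. Then $\mathrm{rev}(T) = \mathrm{erank}(U) + 1$.
   Context: A rooted directed tree is a directed graph $T=(V,E)$ whose underlying undirected graph is a tree and which has a vertex $r$ (the root) reachable by a directed path from every vertex. A persistent reversible pebbling of a directed acyclic graph $G$ with a unique sink $r$ is a sequence $P_1,\dots,P_m$ of subsets of $V$ with $P_1=\emptyset$, $P_m=\{r\}$, and such that for each $2\le i\le m$ there is a vertex $v$ with either $P_i=P_{i-1}\cup\{v\}$ or $P_{i-1}=P_i\cup\{v\}$, $P_i\neq P_{i-1}$, and all in-neighbours of $v$ lie in $P_{i-1}$. The number of pebbles used is $\max_i |P_i|$, and $\mathrm{rev}(G)$ is the minimum number of pebbles used by a persistent reversible pebbling of $G$. An edge rank coloring of an undirected tree $U$ with $k$ colors assigns to each edge a color in $\{1,\dots,k\}$ such that whenever two distinct edges have the same color $i$, the path in $U$ between these two edges contains an edge with some color $j>i$. $\mathrm{erank}(U)$ is the minimum $k$ for which an edge rank coloring of $U$ with $k$ colors exists (it is $0$ if $U$ has no edges). *)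

(* Defs.v *)
From mathcomp Require Import all_boot.
From mathcomp Require Import boolp.

Set Implicit Arguments.
Unset Strict Implicit.
Unset Printing Implicit Defensive.

(* The value is 0 when no natural number satisfies P; see minimumP. *)
Definition minimum (P : nat -> Prop) : nat :=
  if pselect (exists n, `[< P n >]) is left exP then ex_minn exP else 0.

Lemma minimumP (P : nat -> Prop) : (exists n, P n) ->
  P (minimum P) /\ (forall n, P n -> minimum P <= n).
Proof.
move=> [n Pn]; rewrite /minimum; case: pselect => [exP|[]]; last first.
  by exists n; apply/asboolP.
case: ex_minnP => m /asboolP Pm min_m; split=> // k Pk.
by apply: min_m; apply/asboolP.
Qed.

Section Trees.
Variable V : finType.
Implicit Types (g e : rel V) (r : V).

Definition is_tree g : Prop :=
  [/\ symmetric g, irreflexive g, 0 < #|V|,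
      (forall x y, connect g x y)
    & (forall s : seq V, ucycle g s -> size s <= 2)].

(* [e u v] is a directed edge from u to v. *)
Definition underlying e : rel V := [rel x y | e x y || e y x].

(* The first clause forbids pairs of opposite edges, which the simple graph
   [underlying e] cannot detect: as a multigraph they form a 2-cycle. *)
Definition rooted_directed_tree e r : Prop :=
  [/\ (forall x y, e x y -> ~~ e y x),
      is_tree (underlying e)
    & (forall v, connect e v r)].

Definition pebble_move e : rel {set V} := [rel P Q : {set V} |
  [exists v : V, [&& (Q == P :|: [set v]) || (P == Q :|: [set v]),
                     Q != P
                   & [forall u, e u v ==> (u \in P)]]]].

(* The sequence P_1, ..., P_m is [set0 :: Ps]. *)
Definition persistent_pebbling e r (Ps : seq {set V}) : Prop :=
  path (pebble_move e) set0 Ps /\ last set0 Ps = [set r].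

Definition pebbles_used (Ps : seq {set V}) : nat :=
  \max_(P <- set0 :: Ps) #|P|.

(* A positive value of [rev_number] is attained by some pebbling, since the default
   value of [minimum] is 0. *)
Definition rev_number e r : nat :=
  minimum (fun k => exists2 Ps, persistent_pebbling e r Ps
                              & pebbles_used Ps = k).

Definition edges g : {set {set V}} := [set [set x; y] | x in V, y in g x].

Definition path_edges (x : V) (p : seq V) : seq {set V} :=
  pairmap (fun u v => [set u; v]) x p.

(* [s] lists the edges strictly between [a] and [b] on a simple path of [g]
   whose first edge is [a] and last edge is [b].  In a tree, such an [s] exists
   and is unique for all distinct edges [a] and [b]. *)
Definition edges_between g (a b : {set V}) (s : seq {set V}) : Prop :=
  exists x p, [/\ path g x p, uniq (x :: p)
                & path_edges x p = a :: rcons s b].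

(* The values of [c] outside [edges g] are irrelevant.  Since [a] and [b] have
   the same color, it makes no difference that they are excluded from [s]. *)
Definition edge_rank_coloring g (k : nat) (c : {set V} -> nat) : Prop :=
  (forall d, d \in edges g -> 1 <= c d <= k) /\
  (forall a b, a \in edges g -> b \in edges g -> a != b -> c a = c b ->
   forall s, edges_between g a b s -> exists2 d, d \in s & c a < c d).

Definition erank g : nat :=
  minimum (fun k => exists c, edge_rank_coloring g k c).

Lemma edge_rank_coloring_exists g : exists k c, edge_rank_coloring g k c.
Proof.
exists #|{set V}|, (fun d => (enum_rank d).+1); split=> [d _|a b _ _ ab [Eab]].
  by rewrite /= ltn_ord.
by case/negP: ab; apply/eqP/enum_rank_inj/val_inj.
Qed.

End Trees.

(* Main.v *)
Require Import Defs.
From mathcomp Require Import all_boot.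

(** Write T_w for the subtree of all vertices with a directed path to w. An
    edge rank coloring uses its largest color on at most one edge w -> p, and
    cutting it leaves the trees T_w and T \ T_w, so erank is given by the
    recursion 1 + min_w max (erank T_w, erank (T \ T_w)). Pebbling T_w, then
    T \ T_w, and reversing the first pebbling, shows that rev - 1 is at most
    this value.

    Conversely, after the last placement of r a pebbling goes from a configuration
    containing all in-neighbours of r to {r}, with r pebbled throughout; call T
    k-clearable if it has such a walk with at most k + 1 pebbles. If T is
    (k+1)-clearable and has an edge, some edge cuts it into two k-clearable trees.
    First, while all T_z for z in a set of siblings evolve independently of their
    parent, each of them can be kept empty once it has been empty. If w = r, the
    child z of w whose T_z is emptied last therefore has T \ T_z k-clearable, as
    T_z provides a pebble all the time. If T_z is not k-clearable, let w be a
    lowest vertex for which T_w is not. Let h be the first time at which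
    no vertex other than r is pebbled outside T_w and t0 >= h the first such time
    at which w is free. If every T_z with z a child of w were empty at some time
    before t0, then holding w throughout [0, t0) would clear T_w with
    k + 1 pebbles. So some T_z is nonempty during [0, t0); from t0 on we
    ignore w and everything outside T_w, and take the T_z emptied last:
    T \ T_z is k-clearable, and T_z is so by the choice of w. *)

Section Tree.
Set Implicit Arguments.
Unset Strict Implicit.

(** * Paths in the rooted tree *)

Lemma connect_fork (T : finType) (e : rel T) u v z :
    connect e u z -> connect e v z ->
  exists p q, [/\ path e u p /\ path e v q, last u p = last v q,
    uniq (u :: p), uniq (v :: q)
    & forall a, a \in u :: p -> a \in v :: q -> a = last u p].
Proof.
case/connectP=> p0 /shortenP[p ep up _] -> {z p0}.
suff: connect e v (last u p) -> exists p1 q, [/\ path e u p1 /\ path e v q,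
   last u p1 = last v q, {subset p1 <= p}, uniq (u :: p1) /\ uniq (v :: q)
   & forall a, a \in u :: p1 -> a \in v :: q -> a = last u p1].
  by move=> H /H[p1 [q [? ? _ [? ?] ?]]]; exists p1, q.
elim: p u ep up => [|y p IHp] u ep up vz.
  move: vz => /connectP[q0 /shortenP[q eq uq _]] /= lq.
  by exists [::], q; split=> // a; rewrite inE => /eqP.
(* If v reaches u, the branches may meet at u itself. Otherwise no path from v contains u, so
   prepending u to the first branch creates no new common vertex. *)
have [/connectP[q0 /shortenP[q eq uq _] lq]|nvu] := boolP (connect e v u).
  by exists [::], q; split=> // a; rewrite inE => /eqP.
have /andP[euy eyp] := ep; have /andP[uy uyp] := up.
have [p1 [q [[ep1 eq] lpq sp [up1 uq] dis]]] := IHp y eyp uyp vz.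
exists (y :: p1), q; split=> //.
- by rewrite /= euy ep1.
- by move=> a; rewrite !inE => /orP[->//|/sp ->]; rewrite orbT.
- split=> //; rewrite cons_uniq up1 andbT; apply: contra uy; rewrite !inE.
  by case/orP=> [->//|/sp ->]; rewrite orbT.
move=> a; rewrite inE => /orP[/eqP-> uq'|]; last exact: dis.
by case/negP: nvu; apply: (path_connect eq).
Qed.

(** The second branch is traversed backwards; [belast] drops the meeting vertex, which the first
    branch already contributes. *)
Lemma fork_path (T : finType) (g : rel T) u p v q :
    symmetric g -> path g u p -> path g v q -> last u p = last v q ->
    uniq (u :: p) -> uniq (v :: q) ->
    (forall a, a \in u :: p -> a \in v :: q -> a = last u p) ->
  [/\ path g u (p ++ rev (belast v q)), uniq (u :: p ++ rev (belast v q))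
    & last u (p ++ rev (belast v q)) = v].
Proof.
move=> gS gp gq lpq up uq dis; split.
- rewrite cat_path gp lpq rev_path.
  by rewrite (@eq_path _ _ g) // => x y; rewrite gS.
- rewrite -cat_cons cat_uniq up rev_uniq.
  have /andP[lv ub] : (last v q \notin belast v q) && uniq (belast v q).
    by rewrite -rcons_uniq -lastI.
  rewrite ub andbT; apply/hasPn=> a; rewrite mem_rev => ab.
  apply: contraL ab => /dis; rewrite lpq => H.
  apply/negP=> ab; case/negP: lv; rewrite -H //.
  by rewrite lastI mem_rcons inE ab orbT.
rewrite last_cat; case: q lpq {gq uq dis} => [|y q] /= lpq; first by rewrite lpq.
by rewrite rev_cons last_rcons.
Qed.

Variables (V : finType) (e : rel V) (r : V).
Hypothesis hT : rooted_directed_tree e r.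
Local Notation g := (underlying e).

Lemma underlying_sym : symmetric g.
Proof. by move=> x y; rewrite /underlying /= orbC. Qed.

Lemma edge_underlying : subrel e g.
Proof. by move=> x y exy; rewrite /underlying /= exy. Qed.

Lemma connect_root x : connect e x r. Proof. by case: hT. Qed.

(** A directed path back from y to x would close a cycle of the underlying tree. With at most two
    vertices it is a loop or a pair of opposite edges, and both are excluded by antisymmetry. *)
Lemma edge_acyclic x y : e x y -> ~~ connect e y x.
Proof.
case: hT => anti [_ _ _ _ cyc] _ exy; apply/negP.
case/connectP=> p0 /shortenP[p ep up _] lx.
have /cyc : ucycle g (y :: p).
  rewrite /ucycle up andbT /= rcons_path (sub_path edge_underlying) //=.
  by rewrite -lx edge_underlying.
case: p ep up lx => [_ _ xy|z [|//] /=]; last first.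
  by rewrite andbT => eyz _ xz; move: (anti _ _ exy); rewrite xz eyz.
by move: (anti _ _ exy); rewrite xy /= in exy *; rewrite exy.
Qed.

Lemma edge_neq x y : e x y -> x != y.
Proof. by move=> exy; apply: contraTneq (edge_acyclic exy) => ->; rewrite connect0. Qed.

Lemma connect_antisym x y : connect e x y -> connect e y x -> x = y.
Proof.
case/connectP=> [[|z p]] /=; first by move=> _ ->.
move=> /andP[exz zp] yl yx; case/negP: (edge_acyclic exz).
by apply: connect_trans yx; apply/connectP; exists p.
Qed.

(** Both y and z reach r, so their paths meet. Joined through x they form a cycle of the underlying
    tree, whose size bound leaves only y = z. *)
Lemma edge_functional x y z : e x y -> e x z -> y = z.
Proof.
move=> exy exz.
have [p [q [[ep eq] lpq up uq dis]]] := connect_fork (connect_root y) (connect_root z).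
have [gc uc lc] := fork_path underlying_sym (sub_path edge_underlying ep)
  (sub_path edge_underlying eq) lpq up uq dis.
case: hT => _ [_ _ _ _ cyc] _.
have /cyc : ucycle g (x :: y :: p ++ rev (belast z q)).
  rewrite /ucycle /= rcons_path gc (edge_underlying exy) lc /=.
  rewrite underlying_sym (edge_underlying exz) -cons_uniq.
  rewrite cons_uniq uc andbT -cat_cons mem_cat mem_rev negb_or.
  apply/andP; split=> //; apply/andP; split.
    by apply: contra (edge_acyclic exy) => xp; apply: path_connect ep _ xp.
  apply: contra (edge_acyclic exz) => xq; apply: path_connect eq _ _.
  by rewrite lastI mem_rcons inE xq orbT.
by move: lc; case: (p ++ _) => //= ->.
Qed.

Lemma connect_step x y z : e x y -> x != z -> connect e x z -> connect e y z.
Proof.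
move=> exy nxz /connectP[[|y' p]] /=; first by move=> _ zx; rewrite zx eqxx in nxz.
by case/andP=> /(edge_functional exy) <- ep ->; apply/connectP; exists p.
Qed.

(** * Subtrees and cutting them at a vertex *)

Definition below w : {set V} := [set x | connect e x w].

(** The pieces produced by repeated cutting: every vertex of S has its whole directed path to s
    inside S. *)
Definition rooted (S : {set V}) s :=
  [/\ s \in S, S \subset below s
    & forall x y, x \in S -> x != s -> e x y -> y \in S].

Lemma below_edge w x y : e x y -> y \in below w -> x \in below w.
Proof. by move=> exy; rewrite !inE; apply/connect_trans/connect1. Qed.

Lemma below_refl w : w \in below w. Proof. by rewrite inE connect0. Qed.

Lemma rooted_setT : rooted setT r.
Proof. by split=> //; apply/subsetP=> x; rewrite !inE connect_root. Qed.

Lemma rooted_notin_below S s w : rooted S s -> w \in S -> w != s -> s \notin below w.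
Proof.
case=> _ /subsetP sub _ /sub; rewrite !inE => ws; apply: contra => sw.
by rewrite (connect_antisym ws sw).
Qed.

Lemma rooted_below S s w : rooted S s -> w \in S -> rooted (S :&: below w) w.
Proof.
move=> rS wS; have [sS /subsetP sub clS] := rS.
split; first by rewrite inE wS below_refl.
  exact: subsetIr.
move=> x y; rewrite !inE => /andP[xS xw] nxw exy; apply/andP; split; last first.
  exact: connect_step exy nxw xw.
have [xs|nxs] := eqVneq x s; last exact: clS exy.
case/eqP: nxw; apply: connect_antisym xw _; rewrite xs.
by have := sub _ wS; rewrite inE.
Qed.

Lemma rooted_diff S s w : rooted S s -> w \in S -> w != s -> rooted (S :\: below w) s.
Proof.
move=> rS wS nws; have [sS sub clS] := rS.
split; first by rewrite inE sS (rooted_notin_below rS).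
  by apply: subset_trans sub; apply: subsetDl.
move=> x y; rewrite inE => /andP[nxw xS] nxs exy; rewrite inE (clS x) // andbT.
by apply: contra nxw; apply: below_edge.
Qed.

Lemma cut_edge w x y : g x y -> x \in below w -> y \notin below w -> x = w /\ e w y.
Proof.
rewrite /underlying /= !inE => /orP[exy xw nyw|eyx xw]; last first.
  by rewrite (connect_trans (connect1 eyx)).
have [xw'|nxw] := eqVneq x w; first by rewrite -xw'.
by rewrite (connect_step exy nxw xw) in nyw.
Qed.

Lemma rooted_parent S s x : rooted S s -> x \in S -> x != s -> exists2 y, e x y & y \in S.
Proof.
case=> _ /subsetP sub clS xS nxs.
have := sub _ xS; rewrite inE => /connectP[[|y p]] /=.
  by move=> _ xs; rewrite xs eqxx in nxs.
by case/andP=> exy _ _; exists y => //; apply: clS exy.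
Qed.

Lemma rooted_ind S s (P : V -> Prop) : rooted S s -> P s ->
  (forall x y, x \in S -> x != s -> e x y -> y \in S -> P y -> P x) ->
  forall x, x \in S -> P x.
Proof.
move=> rS Ps IH x xS; have [_ /subsetP sub clS] := rS.
have := sub _ xS; rewrite inE => /connectP[p ep sl].
elim: p x xS ep sl => [|y p IHp] x xS /=; first by move=> _ <-.
have [->//|nxs] := eqVneq x s.
case/andP=> exy ep sl; have yS := clS x y xS nxs exy.
exact: IH exy yS (IHp _ yS ep sl).
Qed.

(** * Recursive cuts and edge rank colorings *)

Fixpoint cut_rank k (S : {set V}) s : Prop :=
  if k is k'.+1 then
    S = [set s] \/ exists w, [/\ w \in S, w != s,
      cut_rank k' (S :&: below w) w & cut_rank k' (S :\: below w) s]
  else S = [set s].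

Lemma cut_rankS k S s : cut_rank k S s -> cut_rank k.+1 S s.
Proof.
elim: k S s => [|k IHk] S s; first by left.
by case=> [->|[w [wS nws /IHk ? /IHk ?]]]; [left|right; exists w].
Qed.

(** A relation on all of V rather than on a subtype, so that the edges and colorings of all pieces
    have the same type. *)
Definition restrict (h : rel V) (S : {set V}) : rel V :=
  [rel x y | [&& h x y, x \in S & y \in S]].

Lemma restrict_sub h S : subrel (restrict h S) h.
Proof. by move=> x y /and3P[]. Qed.

Lemma edgesP (h : rel V) d :
  reflect (exists x y, h x y /\ d = [set x; y]) (d \in edges h).
Proof.
apply: (iffP imset2P) => [[x y _ hxy ->]|[x [y [hxy ->]]]]; first by exists x, y.
by exists x y.
Qed.

Lemma path_edgesP (h : rel V) x p d :
  path h x p -> d \in path_edges x p -> exists a b, h a b /\ d = [set a; b].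
Proof.
elim: p x => //= y p IHp x /andP[hxy hp]; rewrite inE => /orP[/eqP->|]; last exact: IHp.
by exists x, y.
Qed.

Lemma path_edges_rcons (x z : V) p :
  path_edges x (rcons p z) = rcons (path_edges x p) [set last x p; z].
Proof. by rewrite /path_edges -!cats1 pairmap_cat. Qed.

Lemma edges_between_path (h : rel V) (x y z : V) p :
    path h x (y :: rcons p z) -> uniq (x :: y :: rcons p z) ->
  edges_between h [set x; y] [set last y p; z] (path_edges y p).
Proof.
by move=> hp up; exists x, (y :: rcons p z); split=> //; rewrite -path_edges_rcons.
Qed.

Lemma connect_last (h : rel V) x p y : path h x p -> y \in x :: p -> connect h y (last x p).
Proof.
move=> hp yp; case/splitPl: p / yp hp => p1 p2 <-.
by rewrite cat_path last_cat => /andP[_ hp2]; apply/connectP; exists p2.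
Qed.

Lemma restrict_connect S s x : rooted S s -> x \in S -> connect (restrict e S) x s.
Proof.
move=> rS; move: x; apply: (rooted_ind rS) => [|x y xS _ exy yS ys]; first exact: connect0.
by apply: connect_trans ys; apply: connect1; apply/and3P.
Qed.

(** The directed paths of u and v towards s meet; together with the given edges they yield the tree
    path between these edges. The disjunction spares a reversal when v lies below u or u below v. *)
Lemma fork_edges_between S s u v u' v' : rooted S s ->
    u \in S -> u' \in S -> e u u' -> v \in S -> v' \in S -> e v v' -> u != v ->
  exists t, edges_between (restrict g S) [set u; u'] [set v; v'] t \/
            edges_between (restrict g S) [set v; v'] [set u; u'] t.
Proof.
move=> rS uS u'S eu vS v'S ev nuv; pose h := restrict g S.
have hsym : symmetric h.
  by move=> x y; rewrite /h /restrict [in LHS]/= [in RHS]/= underlying_sym [(x \in _) && _]andbC.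
have eSh : subrel (restrict e S) h.
  by move=> x y /and3P[exy xS yS]; apply/and3P; split=> //; apply: edge_underlying.
have eSe : subrel (restrict e S) e by apply: restrict_sub.
(* Here b lies on the directed path from a to s: the path from a to b begins with the edge to a' and
   is extended by b', which is new because it cannot reach b. *)
have chain a b b' q : path (restrict e S) a q -> last a q = b -> uniq (a :: q) ->
    a != b -> e b b' -> b \in S -> b' \in S -> forall a', e a a' ->
    exists t, edges_between h [set a; a'] [set b; b'] t.
  case: q => [_ /= -> _|a1 q eq lq uq _ ebb' bS b'S a' eaa']; first by rewrite eqxx.
  have aa1 : a' = a1.
    by apply: (edge_functional eaa'); case/andP: eq => /eSe.
  exists (path_edges a1 q); rewrite aa1 -lq /=; apply: edges_between_path.
    rewrite -rcons_cons rcons_path (sub_path eSh eq) lq andTb.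
    by apply/and3P; split=> //; apply: edge_underlying.
  rewrite -!rcons_cons rcons_uniq uq andbT.
  apply: contra (edge_acyclic ebb') => b'q; rewrite -lq.
  exact: connect_last (sub_path eSe eq) b'q.
have [p [q [[ep eq] lpq up uq dis]]] :=
  connect_fork (restrict_connect rS uS) (restrict_connect rS vS).
case: p ep lpq up dis => [_ /= uv _ _|u1 p ep lpq up dis].
  have [|t ht] := chain v u u' q eq (esym uv) uq _ eu uS u'S v' ev.
    by rewrite eq_sym.
  by exists t; right.
case: q eq lpq uq dis => [_ lpq _ _|v1 q eq lpq uq dis].
  have [t ht] := chain u v v' (u1 :: p) ep lpq up nuv ev vS v'S u' eu.
  by exists t; left.
have uu1 : u' = u1 by apply: (edge_functional eu); case/andP: ep => /eSe.
have vv1 : v' = v1 by apply: (edge_functional ev); case/andP: eq => /eSe.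
(* In a proper fork both branches start with the given edges, so joining them gives the required
   path. *)
have [] := fork_path hsym (sub_path eSh ep) (sub_path eSh eq) lpq up uq dis.
rewrite [belast v _]/= rev_cons -rcons_cat => hp uc _.
exists (path_edges u1 (p ++ rev (belast v1 q))); left.
have -> : [set v; v'] = [set last u1 (p ++ rev (belast v1 q)); v].
  rewrite setUC vv1; congr [set _; _].
  rewrite last_cat; case: q lpq {eq uq dis hp uc} => [|z q] //= _.
  by rewrite rev_cons last_rcons.
by rewrite uu1; apply: edges_between_path.
Qed.

Lemma edge_set_neq u u' v v' : e u u' -> e v v' -> u != v -> [set u; u'] != [set v; v'].
Proof.
move=> eu ev nuv; apply/eqP=> E.
have uv : u \in [set v; v'] by rewrite -E set21.
have vu : v \in [set u; u'] by rewrite E set21.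
case/set2P: uv nuv => [->|uv' nuv]; first by rewrite eqxx.
case/set2P: vu nuv => [->|vu' _]; first by rewrite eqxx.
by have := edge_acyclic eu; rewrite -vu' connect1 // uv'.
Qed.

(** The bound k concerns only the edges inside S, so it can drop along the recursion while c stays
    the same. *)
Lemma coloring_cut_rank (c : {set V} -> nat) :
    (forall d, d \in edges g -> 0 < c d) ->
    (forall a b, a \in edges g -> b \in edges g -> a != b -> c a = c b ->
       forall t, edges_between g a b t -> exists2 d, d \in t & c a < c d) ->
  forall k S s, rooted S s ->
    (forall x y, x \in S -> y \in S -> e x y -> c [set x; y] <= k) -> cut_rank k S s.
Proof.
move=> c_gt0 c_rank.
have eg x y : e x y -> [set x; y] \in edges g.
  by move=> exy; apply/edgesP; exists x, y; split=> //; apply: edge_underlying.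
elim=> [|k IHk] S s rS cS.
  apply/setP=> x; rewrite inE; have [->|nxs] := eqVneq x s; first by case: rS.
  apply/negP=> xS; have [y exy yS] := rooted_parent rS xS nxs.
  by have := c_gt0 _ (eg _ _ exy); rewrite ltnNge cS.
have [/existsP[w /existsP[w' /and4P[wS w'S eww' cw]]]|no_top] :=
    boolP [exists x, exists y, [&& x \in S, y \in S, e x y & k < c [set x; y]]]; last first.
  apply/cut_rankS/IHk => // x y xS yS exy; rewrite leqNgt; apply: contra no_top => kc.
  by apply/existsP; exists x; apply/existsP; exists y; apply/and4P.
have {}cw : c [set w; w'] = k.+1 by apply/eqP; rewrite eqn_leq cS.
have nws : w != s.
  apply: contraTneq w'S => ws; apply/negP=> w'S; have [_ /subsetP sub _] := rS.
  by have := sub _ w'S; rewrite inE -ws; apply/negP/edge_acyclic.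
(* A second edge of color k + 1 would force a larger color on the path between the two, but this
   path runs inside S, where k + 1 is the maximum. *)
have low x y : x \in S -> y \in S -> e x y -> x != w -> c [set x; y] <= k.
  move=> xS yS exy nxw; rewrite leqNgt; apply/negP=> kc.
  have {}kc : c [set x; y] = k.+1 by apply/eqP; rewrite eqn_leq cS.
  have top t a b : edges_between (restrict g S) a b t -> a \in edges g -> b \in edges g ->
      a != b -> c a = k.+1 -> c b = k.+1 -> False.
    move=> abt ag bg nab ca cb.
    have [||d dt] := c_rank a b ag bg nab _ t; first by rewrite ca cb.
    - case: abt => z [p [hp up Ep]]; exists z, p; split=> //.
      by apply: sub_path hp; apply: restrict_sub.
    rewrite ca ltnNge; case/negP; case: abt => z [p [hp _ Ep]].
    have [|u [v [/and3P[guv uS vS] ->]]] := path_edgesP (d := d) hp.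
      by rewrite Ep inE mem_rcons inE dt !orbT.
    by case/orP: guv => ?; [|rewrite setUC]; apply: cS.
  have := edge_set_neq exy eww' nxw => nE.
  have [t [ht|ht]] := fork_edges_between rS xS yS exy wS w'S eww' nxw.
    exact: (top _ _ _ ht (eg _ _ exy) (eg _ _ eww') nE).
  by apply: (top _ _ _ ht (eg _ _ eww') (eg _ _ exy) _ cw kc); rewrite eq_sym.
right; exists w; split=> //; apply: IHk.
- exact: rooted_below rS wS.
- move=> x y /setIP[xS _] /setIP[yS yw] exy; apply: low => //.
  by apply: contraTneq yw => xw; rewrite inE; apply: edge_acyclic; rewrite -xw.
- exact: rooted_diff.
- move=> x y /setDP[xS nxw] /setDP[yS _] exy; apply: low => //.
  by apply: contraNneq nxw => ->; apply: below_refl.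
Qed.

(** Only the edge from w to w' crosses the boundary of [below w], so a path avoiding it stays on the
    side where it starts. *)
Lemma path_avoid_cut S w w' x p : e w w' ->
    path (restrict g S) x p -> [set w; w'] \notin path_edges x p ->
  path (restrict g (if x \in below w then S :&: below w else S :\: below w)) x p.
Proof.
move=> eww'; elim: p x => //= y p IHp x /andP[/and3P[gxy xS yS] hp].
rewrite inE negb_or => /andP[ncut /(IHp _ hp) hp'].
have yx : (y \in below w) = (x \in below w).
  have [xw|nxw] := boolP (x \in below w); last first.
    apply/negP=> yw; have gyx : g y x by rewrite underlying_sym.
    have [yw' ewx] := cut_edge gyx yw nxw.
    by rewrite yw' (edge_functional ewx eww') setUC eqxx in ncut.
  apply: contraNT ncut => nyw; have [-> ewy] := cut_edge gxy xw nyw.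
  by rewrite (edge_functional ewy eww').
rewrite yx in hp'; rewrite hp' andbT; apply/and3P; split=> //.
  by case: ifP => xw; rewrite ?(in_setI, in_setD) xS xw.
by case: ifP => xw; rewrite ?(in_setI, in_setD) yS yx xw.
Qed.

Lemma cut_rank_coloring k S s : rooted S s -> cut_rank k S s ->
  exists c, edge_rank_coloring (restrict g S) k c.
Proof.
have trivial_coloring j S' x : S' = [set x] -> exists c, edge_rank_coloring (restrict g S') j c.
  move=> ->; have none d : d \notin edges (restrict g [set x]).
    apply/negP=> /edgesP[a [b [/and3P[gab /set1P ax /set1P bx] _]]].
    by move: gab; rewrite /underlying /= ax bx orbb => /edge_neq; rewrite eqxx.
  by exists (fun=> 1); split=> [d|a b] ad; rewrite (negPf (none _)) in ad.
elim: k S s => [|k IHk] S s rS; first exact: trivial_coloring.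
case=> [|[w [wS nws /(IHk _ _ (rooted_below rS wS))[c1 [c1r c1s]]]]].
  exact: trivial_coloring.
case/(IHk _ _ (rooted_diff rS wS nws))=> c2 [c2r c2s].
have [w' eww' w'S] := rooted_parent rS wS nws.
pose cut := [set w; w'].
(* The cut edge alone gets the new top color; both sides keep their colorings with k colors. *)
pose c d := if d == cut then k.+1 else if d \subset below w then c1 d else c2 d.
have in_below x p d : path (restrict g (S :&: below w)) x p -> d \in path_edges x p ->
    d \in edges (restrict g (S :&: below w)) /\ c d = c1 d.
  move=> hp /(path_edgesP hp)[a [b [hab ->]]]; split; first by apply/edgesP; exists a, b.
  have /and3P[_ /setIP[_ aw] /setIP[_ bw]] := hab.
  have sw : [set a; b] \subset below w by apply/subsetP=> y /set2P[]->.
  rewrite /c sw; case: eqP => // E; move: sw; rewrite E => /subsetP/(_ w').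
  by rewrite !inE eqxx orbT (negPf (edge_acyclic eww')) => /(_ isT).
have in_diff x p d : path (restrict g (S :\: below w)) x p -> d \in path_edges x p ->
    d \in edges (restrict g (S :\: below w)) /\ c d = c2 d.
  move=> hp /(path_edgesP hp)[a [b [hab ->]]]; split; first by apply/edgesP; exists a, b.
  have /and3P[_ /setDP[_ aw] /setDP[_ bw]] := hab.
  rewrite /c; case: eqP => [E|_].
    have /set2P[] : w \in [set a; b] by rewrite E set21.
      by move=> wa; rewrite -wa below_refl in aw.
    by move=> wb; rewrite -wb below_refl in bw.
  by case: ifP => // /subsetP/(_ a); rewrite set21 (negPf aw) => /(_ isT).
have c_small d : d \in edges (restrict g S) -> d != cut -> 1 <= c d <= k.
  case/edgesP=> x [y [hxy dxy]] ncut.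
  have hp : path (restrict g S) x [:: y] by rewrite /= hxy.
  have /(path_avoid_cut eww' hp) : cut \notin path_edges x [:: y] by rewrite inE -dxy eq_sym.
  have dp : d \in path_edges x [:: y] by rewrite inE dxy.
  case: ifP => _ hp'; first by have [? ->] := in_below _ _ _ hp' dp; apply: c1r.
  by have [? ->] := in_diff _ _ _ hp' dp; apply: c2r.
have c_cut : c cut = k.+1 by rewrite /c eqxx.
exists c; split=> [d dS|a b aS bS nab cab t [x [p [hp up Ep]]]].
  have [->|/(c_small _ dS)/andP[-> /leqW]//] := eqVneq d cut.
  by rewrite c_cut /=.
have small d d' : d \in edges (restrict g S) -> d' \in edges (restrict g S) ->
    d != d' -> c d = c d' -> d != cut /\ c d <= k.
  move=> dS d'S nd cd; have [dc|nc] := eqVneq d cut; last by have /andP[] := c_small _ dS nc.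
  move: nd; rewrite dc eq_sym => /(c_small _ d'S); rewrite -cd dc c_cut ltnn andbF //.
have [nac ca] := small _ _ aS bS nab cab.
have [nbc _] : b != cut /\ c b <= k by apply: small bS aS _ _; rewrite 1?eq_sym.
(* A path through the cut edge meets the top color; any other path lies on one side, where the
   coloring of that side applies. *)
have [ct|nct] := boolP (cut \in t); first by exists cut; rewrite // c_cut.
have /(path_avoid_cut eww' hp) : cut \notin path_edges x p.
  by rewrite Ep inE mem_rcons inE !negb_or ![cut == _]eq_sym nac nbc.
have ap : a \in path_edges x p by rewrite Ep mem_head.
have bp : b \in path_edges x p by rewrite Ep inE mem_rcons mem_head orbT.
have tp d : d \in t -> d \in path_edges x p by move=> dt; rewrite Ep inE mem_rcons inE dt !orbT.
case: ifP => _ hp'.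
  have [a1 ac1] := in_below _ _ _ hp' ap; have [b1 bc1] := in_below _ _ _ hp' bp.
  have [||d dt cd] := c1s a b a1 b1 nab _ t; first by rewrite -ac1 -bc1.
    by exists x, p.
  by exists d => //; have [_ ->] := in_below _ _ _ hp' (tp _ dt); rewrite ac1.
have [a1 ac1] := in_diff _ _ _ hp' ap; have [b1 bc1] := in_diff _ _ _ hp' bp.
have [||d dt cd] := c2s a b a1 b1 nab _ t; first by rewrite -ac1 -bc1.
  by exists x, p.
by exists d => //; have [_ ->] := in_diff _ _ _ hp' (tp _ dt); rewrite ac1.
Qed.

(** * Walks of pebble configurations *)

Implicit Types (S P Q B X F : {set V}).

(** A lazy form of [pebble_move]: idling is allowed and only in-neighbours within S must be pebbled,
    so that moves remain moves after restriction to a piece. *)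
Definition move (S : {set V}) : rel {set V} := [rel P Q : {set V} |
  (P == Q) || [exists v, (P :\ v == Q :\ v) && [forall u in S, e u v ==> (u \in P)]]].

(** B collects the pebbles held during the whole walk: none when a piece is pebbled, its root when
    it is cleared. *)
Definition valid (S B : {set V}) n (P : {set V}) := [&& B \subset P, P \subset S & #|P| <= n].

Definition step S B n : rel {set V} :=
  [rel P Q | [&& valid S B n P, valid S B n Q & move S P Q]].

Lemma moveP S P Q :
  reflect (P = Q \/ exists v, (forall x, x != v -> (x \in P) = (x \in Q)) /\
                              (forall u, u \in S -> e u v -> u \in P))
          (move S P Q).
Proof.
apply: (iffP orP) => [[/eqP|/existsP[v /andP[/eqP E /forall_inP pv]]]|[->|[v [E pv]]]].
- by left.
- right; exists v; split=> [x nxv|u uS euv]; last exact: (implyP (pv u uS)).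
  by move/setP/(_ x): E; rewrite !inE nxv.
- by left.
right; apply/existsP; exists v; apply/andP; split.
  by apply/eqP/setP=> x; rewrite !inE; case: eqVneq => //= /E.
by apply/forall_inP=> u uS; apply/implyP/pv.
Qed.

Lemma move_sym S : symmetric (move S).
Proof.
suff half P Q : move S P Q -> move S Q P by move=> P Q; apply/idP/idP=> /half.
case/moveP=> [->|[v [E pv]]]; apply/moveP; first by left.
right; exists v; split=> [x nxv|u uS euv]; first by rewrite E.
by rewrite -E ?(edge_neq euv) // pv.
Qed.

Lemma step_sym S B n : symmetric (step S B n).
Proof. by move=> P Q; rewrite /step /= move_sym andbCA. Qed.

Lemma move_changed S P Q v : move S P Q -> v \in P -> v \notin Q ->
  (forall x, x != v -> (x \in P) = (x \in Q)) /\ (forall u, u \in S -> e u v -> u \in P).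
Proof.
move=> mPQ vP nvQ; case/moveP: mPQ => [PQ|[x [E px]]]; first by rewrite -PQ vP in nvQ.
by have [->|nvx] := eqVneq v x; [|rewrite E ?(negPf nvQ) in vP].
Qed.

(** As X is closed under in-neighbours in S', a move at a vertex of X never relies on pebbles
    outside X; any other move turns into idling. *)
Lemma move_restrict S S' B X P Q : S' \subset S ->
    (forall u v, u \in S' -> e u v -> v \in X -> u \in X) ->
  move S P Q -> move S' (B :|: P :&: X) (B :|: Q :&: X).
Proof.
move=> /subsetP sS clX /moveP[->|[v [E pv]]]; apply/moveP; first by left.
have [vX|nvX] := boolP (v \in X).
  right; exists v; split=> [x /E xPQ|u uS' euv]; first by rewrite !inE xPQ.
  by rewrite !inE (pv u) ?(clX u v) ?orbT // sS.
left; apply/setP=> x; rewrite !inE; case: (eqVneq x v) => [->|/E->//].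
by rewrite (negPf nvX) !andbF.
Qed.

(** The one vertex that changes is the last pebbled vertex of X. *)
Lemma move_vanish S P Q X : move S P Q -> P :&: X != set0 -> Q :&: X = set0 ->
  P :\: X = Q :\: X.
Proof.
move=> mPQ /set0Pn[v /setIP[vP vX]] QX.
have nvQ : v \notin Q.
  by apply/negP=> vQ; move/setP/(_ v): QX; rewrite !inE vQ vX.
have [E _] := move_changed mPQ vP nvQ.
apply/setP=> x; rewrite !inE; case: (eqVneq x v) => [->|/E->//].
by rewrite vX.
Qed.

Lemma connect_map (T T' : finType) (h : rel T) (h' : rel T') (f : T -> T') x y :
  (forall a b, h a b -> connect h' (f a) (f b)) -> connect h x y -> connect h' (f x) (f y).
Proof.
move=> hf /connectP[p hp ->]; elim: p x hp => [|z p IHp] x /=; first by rewrite connect0.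
by case/andP=> /hf xz /IHp; apply: connect_trans.
Qed.

Lemma connect_walk (T : finType) (h : rel T) (f : nat -> T) t i j :
    symmetric h -> (forall a, a < t -> h (f a) (f a.+1)) -> i <= t -> j <= t ->
  connect h (f i) (f j).
Proof.
move=> hS hf; have from0 : forall a, a <= t -> connect h (f 0) (f a).
  elim=> [|a IHa] at_; first exact: connect0.
  by apply: connect_trans (IHa (ltnW at_)) _; apply/connect1/hf.
move=> it jt; apply: connect_trans (from0 j jt).
by rewrite sym_connect_sym // from0.
Qed.

Lemma connectE_walk (T : finType) (h : rel T) x y : connect h x y ->
  exists (f : nat -> T) m, [/\ f 0 = x, f m = y & forall i, i < m -> h (f i) (f i.+1)].
Proof.
case/connectP=> p hp ->; exists (nth x (x :: p)), (size p); split=> //.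
  by rewrite nth_last.
by move=> i ip; apply: (pathP x hp).
Qed.

Lemma last_true (b : nat -> bool) i j : i <= j -> b i -> ~~ b j ->
  exists a, [/\ i <= a, a < j, b a & ~~ b a.+1].
Proof.
elim: j => [|j IHj]; first by rewrite leqn0 => /eqP-> ->.
rewrite leq_eqVlt => /orP[/eqP-> ->//|]; rewrite ltnS => ij bi nbj.
have [bj|nbj'] := boolP (b j); first by exists j.
by have [a [ia aj ba nba]] := IHj ij bi nbj'; exists a; split=> //; apply: ltnW.
Qed.

Lemma reach_frame S1 S F n m P Q : S1 \subset S -> F \subset S -> n + #|F| <= m ->
    (forall u v, u \in S -> e u v -> v \in S1 -> u \in S1 :|: F) ->
  connect (step S1 set0 n) P Q -> connect (step S set0 m) (P :|: F) (Q :|: F).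
Proof.
move=> sS1 sF nFm pred; apply: (connect_map (f := fun P => P :|: F)) => {}P {}Q.
have validF P' : valid S1 set0 n P' -> valid S set0 m (P' :|: F).
  case/and3P=> _ sP cP; rewrite /valid sub0set subUset (subset_trans sP) // sF /=.
  apply: leq_trans nFm; apply: leq_trans (leq_card_setU _ _) _.
  by rewrite leq_add2r.
case/and3P=> vP vQ mPQ; apply: connect1; rewrite /step /= !validF //=.
case/moveP: mPQ => [->|[v [E pv]]]; apply/moveP; first by left.
have [vS1|nvS1] := boolP (v \in S1).
  right; exists v; split=> [x /E xE|u uS euv]; first by rewrite !inE xE.
  have := pred u v uS euv vS1; rewrite !inE => /orP[uS1|->]; last by rewrite orbT.
  by rewrite pv.
left; congr (_ :|: _); apply/setP=> x; case: (eqVneq x v) => [->|/E//].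
have nv P' : valid S1 set0 n P' -> (v \in P') = false.
  by case/and3P=> _ /subsetP sP' _; apply: contraNF nvS1; apply: sP'.
by rewrite !nv.
Qed.

Lemma cut_rank_reach k S s : rooted S s -> cut_rank k S s ->
  connect (step S set0 k.+1) set0 [set s].
Proof.
have base j S' x : S' = [set x] -> connect (step S' set0 j.+1) set0 [set x].
  move=> ->; apply: connect1; rewrite /step /valid /= !sub0set cards0 cards1 subxx /=.
  apply/moveP; right; exists x; split=> [y nyx|u /set1P-> /edge_neq].
    by rewrite !inE (negPf nyx).
  by rewrite eqxx.
elim: k S s => [|k IHk] S s rS; first exact: base.
case=> [|[w [wS nws /(IHk _ _ (rooted_below rS wS)) r1 /(IHk _ _ (rooted_diff rS wS nws)) r2]]].
  exact: base.
have sS : s \in S by case: rS.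
have clw u v : u \in S -> e u v -> v \in S :&: below w -> u \in S :&: below w.
  by move=> uS euv /setIP[_ vw]; rewrite inE uS (below_edge euv).
(* Three phases, each with k + 1 pebbles on one side and at most one held on the other: pebble w;
   pebble s while w is held; remove w by reversing the first phase while s is held. *)
have q1 : connect (step S set0 k.+2) (set0 :|: set0) ([set w] :|: set0).
  apply: reach_frame r1; rewrite ?subsetIl ?sub0set ?cards0 ?addn0 //.
  by move=> u v uS euv vw; rewrite setU0; apply: clw euv vw.
have q2 : connect (step S set0 k.+2) (set0 :|: [set w]) ([set s] :|: [set w]).
  apply: reach_frame r2; rewrite ?subsetDl ?sub1set ?cards1 ?addn1 //.
  move=> u v uS euv /setDP[vS nvw]; rewrite in_setU in_setD uS andbT in_set1.
  have [uw|//] := boolP (u \in below w).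
  by have [-> _] := cut_edge (edge_underlying euv) uw nvw; rewrite eqxx orbT.
have q3 : connect (step S set0 k.+2) (set0 :|: [set s]) ([set w] :|: [set s]).
  apply: reach_frame r1; rewrite ?subsetIl ?sub1set ?cards1 ?addn1 //.
  by move=> u v uS euv vw; rewrite in_setU (clw _ _ uS euv vw).
rewrite !setU0 in q1; rewrite set0U in q2; rewrite set0U setUC in q3.
apply: connect_trans q1 (connect_trans q2 _).
by rewrite (sym_connect_sym (@step_sym _ _ _)).
Qed.

Lemma pebble_move_step n (P Q : {set V}) : step setT set0 n P Q -> P != Q -> pebble_move e P Q.
Proof.
case/and3P=> _ _ /moveP[->|[v [E pv]]] nPQ; first by rewrite eqxx in nPQ.
apply/existsP; exists v; apply/and3P; split; last first.
- by apply/forallP=> u; apply/implyP; apply: pv.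
- by rewrite eq_sym.
have [vP|nvP] := boolP (v \in P); apply/orP; [right|left]; apply/eqP/setP=> x;
  rewrite !inE; case: (eqVneq x v) => [->|/E->]; rewrite ?orbF ?orbT //.
apply: contraNT nPQ => nvQ; apply/eqP/setP=> y.
by case: (eqVneq y v) => [->|/E//]; rewrite (negPf nvP) (negPf nvQ).
Qed.

Lemma reach_pebbling n : connect (step setT set0 n) set0 [set r] ->
  exists2 Ps, persistent_pebbling e r Ps & pebbles_used Ps <= n.
Proof.
case/connectP=> p; set P0 := (X in path _ X) => hp lp.
have: exists ps, [/\ path (pebble_move e) P0 ps, last P0 ps = last P0 p
                  & all (fun P : {set V} => #|P| <= n) ps].
  elim: p (P0) hp {lp} => [|Q p IHp] P /=; first by exists [::].
  case/andP=> sPQ /IHp[ps [hps lps aps]].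
  (* Idle steps are dropped, since [pebble_move] requires a change. *)
  have [->|nPQ] := eqVneq P Q; first by exists ps.
  exists (Q :: ps); split=> //=; first by rewrite (pebble_move_step sPQ nPQ).
  by rewrite aps andbT; case/and3P: sPQ => _ /and3P[].
case=> ps [hps lps /allP aps]; exists ps; first by split=> //; rewrite lp.
apply/bigmax_leqP_seq=> P; rewrite inE => /orP[/eqP-> _|/aps//].
by rewrite cards0.
Qed.

Lemma pebble_move_move P Q : pebble_move e P Q -> move setT P Q.
Proof.
case/existsP=> v /and3P[PQ _ /forallP pv]; apply/moveP; right; exists v; split.
  by move=> x nxv; case/orP: PQ => /eqP->; rewrite !inE (negPf nxv) orbF.
by move=> u _; apply/implyP.
Qed.

(** * Lower bound: cutting clearable trees *)

Definition clearable S s k := [exists A : {set V},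
  [&& s \in A, [forall u in S, e u s ==> (u \in A)] & connect (step S [set s] k.+1) A [set s]]].

Lemma clearable_walk S s k : s \in S -> clearable S s k ->
  exists (P : nat -> {set V}) m,
    [/\ forall i, i <= m -> valid S [set s] k.+1 (P i),
        forall i, i < m -> move S (P i) (P i.+1),
        forall u, u \in S -> e u s -> u \in P 0
      & P m = [set s]].
Proof.
move=> sS /existsP[A /and3P[sA /forall_inP predA /connectE_walk[P [m [P0 Pm Pstep]]]]].
exists P, m; split=> // [i|i im|u uS eus].
- rewrite leq_eqVlt => /orP[/eqP->|/Pstep/and3P[]//].
  by rewrite Pm /valid subxx sub1set sS cards1.
- by case/and3P: (Pstep i im).
by rewrite P0; apply: (implyP (predA u uS)).
Qed.

Lemma below_child S s w x : rooted S s -> w \in S -> x \in S :&: below w -> x != w ->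
  exists c, [/\ c \in S, e c w & x \in below c].
Proof.
move=> rS wS xS; pose Q x := x != w -> exists c, [/\ c \in S, e c w & x \in below c].
suff: Q x by []; move: x xS; apply: (rooted_ind (rooted_below rS wS)) => [|x y]; rewrite /Q.
  by rewrite eqxx.
move=> /setIP[xS _] nxw exy _ IHy _; have [yw|nyw] := eqVneq y w.
  by exists x; split=> //; [rewrite -yw | apply: below_refl].
by have [c [cS cw yc]] := IHy nyw; exists c; split=> //; apply: below_edge exy yc.
Qed.

Lemma child_neq_root S s w z : rooted S s -> w \in S -> e z w -> z != s.
Proof.
case=> _ /subsetP sub _ /sub; rewrite inE => ws ezw.
by apply: contraTneq ws => <-; apply: edge_acyclic.
Qed.

Section Walk.
Variables (S : {set V}) (P : nat -> {set V}) (t : nat).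
Hypothesis movesP : forall i, i < t -> move S (P i) (P i.+1).

(** Since steps are reversible, i and j may come in either order; this allows going back and forth
    between the times at which different subtrees are empty. *)
Lemma walk_reach S' X b n i j : S' \subset S -> b \in S' -> X \subset S' ->
    (forall u v, u \in S' -> e u v -> v \in X -> u \in X) ->
    (forall a, a <= t -> #|b |: P a :&: X| <= n) -> i <= t -> j <= t ->
  connect (step S' [set b] n) (b |: P i :&: X) (b |: P j :&: X).
Proof.
move=> sS bS' sX clX size_le; apply: (connect_walk (f := fun a => b |: P a :&: X)).
  exact: step_sym.
have ok a : a <= t -> valid S' [set b] n (b |: P a :&: X).
  move=> at_; rewrite /valid subsetUl subUset sub1set bS' size_le // andbT /=.
  by apply: subset_trans sX; apply: subsetIr.
move=> a lt_at; apply/and3P; split; [exact/ok/ltnW|exact: ok|].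
exact: (move_restrict [set b] sS clX (movesP lt_at)).
Qed.

(* As b stays pebbled, the subtrees below the children cs evolve independently:
   walk to a time at which the next one is empty, and drop it from then on. *)
Lemma clear_children S' X b w n (cs : seq V) i : S' \subset S -> b \in S' -> X \subset S' ->
    (forall u v, u \in S' -> e u v -> v \in X -> u \in X) ->
    w \notin X -> (forall c, c \in cs -> e c w) ->
    (forall x, x \in X -> exists2 c, c \in cs & x \in below c) ->
    (forall c, c \in cs -> exists2 j, j <= t & P j :&: below c = set0) ->
    (forall a, a <= t -> #|b |: P a :&: X| <= n) -> i <= t ->
  connect (step S' [set b] n) (b |: P i :&: X) [set b].
Proof.
move=> sS bS'; elim: cs X i => [|c cs IHcs] X i sX clX nwX ecs Xcs emp size_le it.
  have -> : X = set0 by apply/setP=> x; rewrite inE; apply/negP=> /Xcs[].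
  by rewrite setI0 setU0 connect0.
have [j jt Pjc] := emp c (mem_head _ _).
apply: connect_trans (walk_reach sS bS' sX clX size_le it jt) _.
have -> : P j :&: X = P j :&: (X :\: below c).
  apply/setP=> x; rewrite in_setI in_setI in_setD.
  case Pjx: (x \in P j) => //=; case xc: (x \in below c) => //=.
  by move/setP/(_ x): Pjc; rewrite in_setI Pjx xc inE.
have ecw := ecs c (mem_head _ _).
apply: IHcs => //.
- by apply: subset_trans sX; apply: subsetDl.
- move=> u v uS' euv /setDP[vX nvc]; rewrite in_setD (clX u v) // andbT.
  apply/negP=> uc; have [uc' ecv] := cut_edge (edge_underlying euv) uc nvc.
  by rewrite -(edge_functional ecv ecw) vX in nwX.
- by rewrite in_setD negb_and nwX orbT.
- by move=> c' c'cs; apply: ecs; rewrite inE c'cs orbT.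
- move=> x /setDP[/Xcs[c' + xc'] nxc]; rewrite inE => /orP[/eqP cc'|]; last by exists c'.
  by rewrite -cc' xc' in nxc.
- by move=> c' c'cs; apply: emp; rewrite inE c'cs orbT.
move=> a /size_le; apply: leq_trans; apply: subset_leq_card.
by apply: setUS; apply: setIS; apply: subsetDl.
Qed.
End Walk.

(* z is the child of w whose subtree is emptied last; until then it holds a
   pebble, so that the rest of S makes do with one pebble less. *)
Lemma clearable_diff_child S s k (P : nat -> {set V}) m w h t0 z0 : rooted S s ->
    (forall i, i <= m -> valid S [set s] k.+2 (P i)) ->
    (forall i, i < m -> move S (P i) (P i.+1)) ->
    (forall u, u \in S -> e u s -> u \in P 0) -> P m = [set s] ->
    w \in S -> h <= t0 -> t0 <= m -> P h \subset s |: below w ->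
    (w \notin P t0) || (w == s) ->
    z0 \in S -> e z0 w -> P 0 :&: below z0 != set0 ->
    (forall i, i < t0 -> P i :&: below z0 != set0) ->
  exists z, [/\ z \in S, e z w & clearable (S :\: below z) s k].
Proof.
move=> rS vP mP pred0 Pm wS ht0 t0m Ph wt0 z0S ez0 ne0 ne_t0.
have sS : s \in S by case: rS.
(* The first time at which the subtree of z is empty; it is at most m because only s is pebbled at
   the end. *)
pose fe z := find (fun i => P i :&: below z == set0) (iota 0 m.+1).
have s_below z : z \in S -> e z w -> s \notin below z.
  by move=> zS ezw; apply: rooted_notin_below rS zS (child_neq_root rS wS ezw).
have feP z : z \in S -> e z w -> [/\ fe z <= m, P (fe z) :&: below z = set0
    & forall i, i < fe z -> P i :&: below z != set0].
  move=> zS ezw.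
  have hz : has (fun i => P i :&: below z == set0) (iota 0 m.+1).
    apply/hasP; exists m; first by rewrite mem_iota add0n ltnS leqnn.
    rewrite Pm; apply/eqP/setP=> x; rewrite in_setI in_set1 in_set0.
    by case: eqP => //= ->; apply/negbTE/s_below.
  have lt_fe : fe z < m.+1 by move: hz; rewrite has_find size_iota.
  split=> [||i ife]; first by rewrite -ltnS.
    by apply/eqP; move: (nth_find 0 hz); rewrite nth_iota.
  have := before_find 0 ife; rewrite nth_iota ?add0n => [->//|].
  exact: ltn_trans ife lt_fe.
case: (@arg_maxnP _ z0 (fun z => (z \in S) && e z w) fe); first by rewrite z0S.
move=> z /andP[zS ezw] zmax; exists z; split=> //.
have [fe_m fe_emp fe_ne] := feP z zS ezw.
have [_ fe0_emp _] := feP z0 z0S ez0.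
have fe0_t0 : t0 <= fe z0.
  by rewrite leqNgt; apply/negP=> /ne_t0; rewrite fe0_emp eqxx.
(* For t0 = 0 the nonemptiness up to t0 says nothing, so positivity rests on [ne0]. *)
have fe0_gt0 : 0 < fe z0.
  by rewrite lt0n; apply: contraNneq ne0 => E; rewrite -{1}E fe0_emp.
have fe_max z' : z' \in S -> e z' w -> fe z' <= fe z.
  by move=> z'S ez'w; apply: zmax; rewrite z'S.
have t0_fe : t0 <= fe z := leq_trans fe0_t0 (fe_max _ z0S ez0).
have fe_gt0 : 0 < fe z := leq_trans fe0_gt0 (fe_max _ z0S ez0).
set t := fe z in fe_m fe_emp fe_ne fe_max t0_fe fe_gt0 *.
pose S' := S :\: below z.
have sP i : i <= m -> s \in P i by move/vP/and3P=> []; rewrite sub1set.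
have sS' : s \in S' by rewrite in_setD s_below.
have subS' : S' \subset S := subsetDl _ _.
have size_lt i : i < t -> #|P i :\: below z| <= k.+1.
  move=> it; have /and3P[_ _] := vP i (leq_trans (ltnW it) fe_m).
  rewrite -(cardsID (below z) (P i)) => le2.
  rewrite -ltnS; apply: leq_trans le2; rewrite -addn1 addnC.
  by rewrite leq_add2r card_gt0 fe_ne.
have size_le i : i <= t -> #|P i :\: below z| <= k.+1.
  rewrite leq_eqVlt => /orP[/eqP->|]; last exact: size_lt.
  (* The move into time t takes the last pebble out of [below z] and changes nothing else, so the
     bound at t - 1 carries over. *)
  case Et: t fe_gt0 => [//|t'] _; rewrite Et in fe_m fe_emp fe_ne size_lt.
  by rewrite -(move_vanish (mP t' fe_m) (fe_ne t' (ltnSn _)) fe_emp) size_lt.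
have moves i : i < t -> move S (P i) (P i.+1).
  by move=> it; apply: mP; apply: leq_trans it fe_m.
have size_X X i : X \subset S' -> i <= t -> #|s |: P i :&: X| <= k.+1.
  move=> /subsetP sX it; apply: leq_trans (size_le i it); apply: subset_leq_card.
  apply/subsetP=> x /setU1P[->|/setIP[xP /sX/setDP[_ nxz]]]; last by rewrite in_setD nxz.
  by rewrite in_setD s_below // sP // (leq_trans it).
have clS' u v : u \in S' -> e u v -> v \in S' -> u \in S' by [].
(* Pebbles are forgotten in stages: all of S' is kept up to h, only [X2] from h to t0, only [X3]
   afterwards. Nothing is lost at h or t0, as the only possible extra pebble is the one held on s,
   even if w = s. *)
pose X2 := S' :&: below w; pose X3 := X2 :\ w.
have subX2 : X2 \subset S' := subsetIl _ _.
have subX3 : X3 \subset S' := subset_trans (subsetDl _ _) subX2.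
have clX2 u v : u \in S' -> e u v -> v \in X2 -> u \in X2.
  by move=> uS' euv /setIP[_ vw]; rewrite in_setI uS' (below_edge euv).
have clX3 u v : u \in S' -> e u v -> v \in X3 -> u \in X3.
  move=> uS' euv /setD1P[nvw vX2]; rewrite in_setD1 (clX2 u v) // andbT.
  apply: contraTneq vX2 => uw; rewrite in_setI negb_and; apply/orP; right.
  by rewrite inE; apply: edge_acyclic; rewrite -uw.
have ht : h <= t := leq_trans ht0 t0_fe.
have reach1 : connect (step S' [set s] k.+1) (s |: P 0 :&: S') (s |: P h :&: S').
  by apply: (walk_reach moves) => // a; apply: size_X.
have reach2 : connect (step S' [set s] k.+1) (s |: P h :&: X2) (s |: P t0 :&: X2).
  by apply: (walk_reach moves) => // a; apply: size_X.
have Eh : s |: P h :&: S' = s |: P h :&: X2.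
  apply/setP=> x; rewrite !in_setU1 /X2 setIA [in RHS]in_setI.
  case: eqVneq => //= nxs; case xP: (x \in P h :&: S') => //=.
  move/subsetP/(_ x): Ph; case/setIP: xP => -> _ /(_ isT).
  by rewrite in_setU1 (negPf nxs) /= => ->.
have Et0 : s |: P t0 :&: X2 = s |: P t0 :&: X3.
  apply/setP=> x; rewrite !in_setU1 !in_setI in_setD1 in_setI.
  case: (eqVneq x s) => //= nxs; case: (eqVneq x w) => //= xw.
  by move: wt0; rewrite -xw (negPf nxs) orbF => /negPf->.
apply/existsP; exists (s |: P 0 :&: S'); apply/and3P; split.
- exact: setU11.
- apply/forall_inP=> u uS'; apply/implyP=> eus; rewrite in_setU1 in_setI uS' andbT.
  by rewrite pred0 ?orbT // (subsetP subS').
apply: connect_trans reach1 _; rewrite Eh; apply: connect_trans reach2 _; rewrite Et0.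
pose cs := [seq c <- enum V | [&& c \in S, e c w & c != z]].
apply: (@clear_children S P t moves S' X3 s w k.+1 cs t0) => //.
- by rewrite /X3 in_setD1 eqxx.
- by move=> c; rewrite mem_filter => /andP[/and3P[]].
- move=> x /setD1P[nxw /setIP[/setDP[xS nxz] xw]].
  have [|c [cS ecw xc]] := below_child rS wS _ nxw; first by rewrite in_setI xS.
  exists c => //; rewrite mem_filter cS ecw mem_enum andbT /=.
  by apply: contraNneq nxz => <-.
- move=> c; rewrite mem_filter => /andP[/and3P[cS ecw _] _].
  by exists (fe c); [apply: fe_max | have [] := feP c cS ecw].
by move=> a; apply: size_X.
Qed.

Lemma root_child S s : rooted S s -> S != [set s] -> exists2 z, z \in S & e z s.
Proof.
move=> rS nS; have [sS /subsetP subS _] := rS.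
have [x] : exists x, x \in S :\ s.
  by apply/set0Pn; apply: contra nS; rewrite setD_eq0 => sub; rewrite eqEsubset sub sub1set.
move=> /setD1P[nxs xS]; have [|c [cS ecs _]] := below_child rS sS _ nxs.
  by rewrite inE xS subS.
by exists c.
Qed.

Lemma clearable_cut S s k : rooted S s -> clearable S s k.+1 -> S != [set s] ->
  exists w, [/\ w \in S, w != s, clearable (S :&: below w) w k & clearable (S :\: below w) s k].
Proof.
move=> rS clS nS; have [sS /subsetP subS _] := rS.
have [P [m [vP mP pred0 Pm]]] := clearable_walk sS clS.
have sP i : i <= m -> s \in P i by move/vP/and3P=> []; rewrite sub1set.
have leS i : i <= m -> #|P i| <= k.+2 by move/vP/and3P=> [].
(* The instance w = s with h = t0 = 0; every child of s is pebbled at time 0. *)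
have [u0 [u0S eu0s Su0]] : exists u, [/\ u \in S, e u s & clearable (S :\: below u) s k].
  have [z0 z0S ez0] := root_child rS nS.
  apply: (clearable_diff_child rS vP mP pred0 Pm sS (leqnn 0) (leq0n m) _ _ z0S ez0) => //.
  - apply/subsetP=> x xP; rewrite in_setU1 subS ?orbT //.
    by have /and3P[_ /subsetP-> //] := vP 0 (leq0n m).
  - by rewrite eqxx orbT.
  by apply/set0Pn; exists z0; rewrite in_setI pred0 // below_refl.
have nu0s := child_neq_root rS sS eu0s.
have [clu|hvu] := boolP (clearable (S :&: below u0) u0 k); first by exists u0.
pose heavy w := [&& w \in S, w != s & ~~ clearable (S :&: below w) w k].
have heavy_u : heavy u0 by apply/and3P.
case: (@arg_minnP _ u0 heavy (fun w => #|below w|) heavy_u) => w /and3P[wS nws hvw] minw.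
have light z : z \in S -> e z w -> clearable (S :&: below z) z k.
  move=> zS ezw; apply: contraT => hvz.
  have /minw : heavy z by rewrite /heavy zS (child_neq_root rS wS).
  rewrite leqNgt; case/negP; apply: proper_card; apply/properP; split.
    by apply/subsetP=> x; rewrite !inE => xz; apply: connect_trans xz (connect1 ezw).
  by exists w; rewrite ?below_refl // inE edge_acyclic.
suff [z [zS ezw clz]] : exists z, [/\ z \in S, e z w & clearable (S :\: below z) s k].
  by exists z; split=> //; [apply: child_neq_root rS wS ezw | apply: light].
have nsw : s \notin below w := rooted_notin_below rS wS nws.
have Pm_diff : P m :\: below w == [set s].
  by rewrite Pm; apply/eqP/setP=> x; rewrite in_setD in_set1 andbC; case: eqP => //= ->.
have [h [hm /eqP Ph h_min]] : exists h, [/\ h <= m, P h :\: below w == [set s]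
    & forall i, i < h -> P i :\: below w != [set s]].
  have ex : exists i, P i :\: below w == [set s] by exists m.
  case: (ex_minnP ex) => h hP hmin; exists h; split=> //; first exact: hmin.
  by move=> i; apply: contraTN => /hmin; rewrite -leqNgt.
have [t0 [ht0 t0m nwt0 t0_min]] : exists t0, [/\ h <= t0, t0 <= m, w \notin P t0
    & forall i, h <= i -> i < t0 -> w \in P i].
  have mP0 : (h <= m) && (w \notin P m) by rewrite hm Pm in_set1.
  have ex : exists i, (h <= i) && (w \notin P i) by exists m.
  case: (ex_minnP ex) => t0 /andP[ht0 nwt0] tmin; exists t0; split=> //; first exact: tmin.
  move=> i hi; apply: contraTT => nwi; rewrite -leqNgt; apply: tmin.
  by rewrite hi.
(* By induction down the path from s to w, every vertex on it is pebbled at some time up to h: a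
   child of s at time 0, and a lower one when its parent loses its pebble, which happens by time h
   since the parent lies outside [below w]. *)
have visited : exists2 j, j <= h & w \in P j.
  suff Q x : x \in S -> x != s -> (forall y, e x y -> y \notin below w) ->
      exists2 j, j <= h & x \in P j.
    by apply: Q wS nws _ => y ewy; rewrite inE edge_acyclic.
  move: x; apply: (rooted_ind rS) => [|x y xS _ exy yS IHy _ out]; first by rewrite eqxx.
  have [ys|nys] := eqVneq y s; first by exists 0; rewrite // pred0 -?ys.
  have nyw := out y exy.
  have [|j jh yPj] := IHy nys; first by move=> z eyz; apply: contra nyw; apply: below_edge.
  have nyPh : y \notin P h.
    by move/setP/(_ y): Ph; rewrite in_setD in_set1 nyw (negPf nys) /= => ->.
  have [a [_ ah yPa nyPa]] := last_true (b := fun i => y \in P i) jh yPj nyPh.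
  have [_ preda] := move_changed (mP a (leq_trans ah hm)) yPa nyPa.
  by exists a; [apply: ltnW | apply: preda].
have [j jh wPj] := visited.
(* The move after time a lifts the pebble from w, so the in-neighbours of w are pebbled at time a.
   Clearing [below w] can start from there. *)
have [a [_ at0 wPa nwPa]] := last_true (b := fun i => w \in P i) (leq_trans jh ht0) wPj nwt0.
have t0_gt0 : 0 < t0 by apply: leq_ltn_trans at0.
have [/existsP[z0 /and3P[z0S ez0 /forallP ne]]|none] := boolP [exists z0,
    [&& z0 \in S, e z0 w & [forall i : 'I_t0, P i :&: below z0 != set0]]].
  have ne_lt i : i < t0 -> P i :&: below z0 != set0 by move=> it; apply: (ne (Ordinal it)).
  apply: (clearable_diff_child rS vP mP pred0 Pm wS ht0 t0m _ _ z0S ez0) => //.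
  - apply/subsetP=> x xP; rewrite in_setU1 orbC; case: (boolP (x \in below w)) => //= nxw.
    by move/setP/(_ x): Ph; rewrite in_setD nxw xP in_set1.
  - by rewrite nwt0.
  exact: ne_lt.
case/negP: hvw; pose S' := S :&: below w.
have wS' : w \in S' by rewrite in_setI wS below_refl.
(* Holding w is affordable before time t0: w is pebbled anyway from h on, and
   before h at least two pebbles lie outside of below w. *)
have size_le i : i < t0 -> #|w |: P i :&: below w| <= k.+1.
  move=> it; have im : i <= m := ltnW (leq_trans it t0m).
  have le_i := leS i im; rewrite -(cardsID (below w) (P i)) in le_i.
  have s_diff : s \in P i :\: below w by rewrite in_setD nsw sP.
  have [ih|hi] := ltnP i h.
    have gt1 : 1 < #|P i :\: below w|.
      have /negP := h_min i ih; rewrite ltnNge => ne; apply/negP=> le1; case: ne.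
      by rewrite eq_sym eqEcard sub1set s_diff cards1.
    apply: leq_trans (leq_card_setU _ _) _; rewrite cards1 add1n ltnS.
    by rewrite -(leq_add2r 2) [k + 2]addn2; apply: leq_trans le_i; rewrite leq_add2l.
  rewrite (setUidPr _); last by rewrite sub1set in_setI t0_min // below_refl.
  rewrite -ltnS -addn1; apply: leq_trans le_i; rewrite leq_add2l card_gt0.
  by apply/set0Pn; exists s.
have [_ preda] := move_changed (mP a (leq_trans at0 t0m)) wPa nwPa.
apply/existsP; exists (w |: P a :&: (S' :\ w)); apply/and3P; split.
- exact: setU11.
- apply/forall_inP=> u uS'; apply/implyP=> euw; rewrite in_setU1 in_setI in_setD1 uS'.
  by rewrite (edge_neq euw) preda ?orbT //; case/setIP: uS'.
pose cs := [seq c <- enum V | (c \in S) && e c w].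
(* The walk ends at t0 - 1 because [size_le] covers only times before t0, and every child subtree is
   empty at such a time. *)
apply: (@clear_children S P t0.-1 _ S' (S' :\ w) w w k.+1 cs a) => //.
- by move=> i it; apply: mP; apply: leq_trans t0m; rewrite -(prednK t0_gt0) ltnS ltnW.
- exact: subsetIl.
- exact: subsetDl.
- move=> u v /setIP[uS uw] euv /setD1P[nvw /setIP[vS vw]].
  rewrite in_setD1 in_setI uS uw /= andbT; apply: contraTneq vw => uw'.
  by rewrite inE edge_acyclic -?uw'.
- by rewrite in_setD1 eqxx.
- by move=> c; rewrite mem_filter => /andP[/andP[]].
- move=> x /setD1P[nxw xS']; have [c [cS ecw xc]] := below_child rS wS xS' nxw.
  by exists c; rewrite // mem_filter cS ecw mem_enum.
- move=> c; rewrite mem_filter => /andP[/andP[cS ecw] _].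
  move: none; rewrite negb_exists => /forallP/(_ c); rewrite cS ecw negb_forall.
  case/existsP=> i; rewrite negbK => /eqP Pi; exists i => //.
  by rewrite -ltnS prednK.
- move=> i it; have {}it : i < t0 by rewrite -(prednK t0_gt0) ltnS.
  apply: leq_trans (size_le i it); apply: subset_leq_card; apply: setUS; apply: setIS.
  by apply: subset_trans (subsetDl _ _) _; apply: subsetIr.
by rewrite -ltnS prednK.
Qed.

Lemma clearable_cut_rank k S s : rooted S s -> clearable S s k -> cut_rank k S s.
Proof.
elim: k S s => [|k IHk] S s rS clS.
  have [sS _ _] := rS; have [P [m [vP _ pred0 _]]] := clearable_walk sS clS.
  have /and3P[] := vP 0 (leq0n m); rewrite sub1set => sP0 _ P0_le1.
  apply/eqP; apply: contraT => /(root_child rS)[z zS ezs].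
  (* A single pebble cannot occupy both s and a child of s at time 0. *)
  have /card_le1_eqP/(_ z s (pred0 z zS ezs) sP0) zs := P0_le1.
  by have := edge_neq ezs; rewrite zs eqxx.
case: (eqVneq S [set s]) => [->|nS]; [by left|right].
have [w [wS nws cl1 cl2]] := clearable_cut rS clS nS.
exists w; split=> //; apply: IHk => //; [exact: rooted_below rS wS|exact: rooted_diff].
Qed.

(** * From pebblings to clearings, and the equality *)

Lemma pebbling_clearable k Ps :
  persistent_pebbling e r Ps -> pebbles_used Ps <= k.+1 -> clearable setT r k.
Proof.
case=> hPs lPs used; pose f i := nth set0 (set0 :: Ps) i; pose m := size Ps.
have fm : f m = [set r] by rewrite /f /m -lPs nth_last.
have fstep i : i < m -> pebble_move e (f i) (f i.+1) by move=> im; apply: (pathP set0 hPs).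
have fsize i : i <= m -> #|f i| <= k.+1.
  move=> im; apply: leq_trans used.
  apply: (@leq_bigmax_seq _ _ xpredT (fun P : {set V} => #|P|)) => //.
  by apply: mem_nth.
(* The last time without a pebble on r; it exists because the sequence starts with the empty set. *)
have [j [/andP[jm nrj] jmax]] : exists j, (j <= m) && (r \notin f j) /\
    forall i, (i <= m) && (r \notin f i) -> i <= j.
  have ex : exists j, (j <= m) && (r \notin f j) by exists 0; rewrite /f /= in_set0.
  case: (ex_maxnP ex (m := m)) => [i /andP[] //|j hj jmax]; by exists j.
have jm' : j < m.
  by rewrite ltn_neqAle jm andbT; apply: contraNneq nrj => ->; rewrite fm set11.
have rf i : j < i -> i <= m -> r \in f i.
  by move=> ji im; apply: contraLR ji => nri; rewrite -leqNgt; apply: jmax; rewrite im.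
(* Read backwards, the final placement of r is a removal, which shows that the in-neighbours of r
   are pebbled. *)
have mj := pebble_move_move (fstep j jm'); rewrite move_sym in mj.
have [_ predj] := move_changed mj (rf _ (ltnSn j) jm') nrj.
apply/existsP; exists (f j.+1); apply/and3P; split.
- exact: rf.
- by apply/forall_inP=> u uT; apply/implyP; apply: predj.
rewrite -[X in connect _ _ X]fm; pose h i := f (j.+1 + i).
have -> : f m = h (m - j.+1) by rewrite /h subnKC.
have -> : f j.+1 = h 0 by rewrite /h addn0.
have vh i : i <= m - j.+1 -> valid setT [set r] k.+1 (h i).
  move=> im; have {}im : j.+1 + i <= m by rewrite -(subnKC jm') leq_add2l.
  by rewrite /valid subsetT sub1set rf ?fsize // ltnS leq_addr.
apply: (connect_walk (f := h) (t := m - j.+1)) => // [|i im]; first exact: step_sym.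
apply/and3P; split; [exact/vh/ltnW|exact: vh|].
rewrite /h addnS; apply/pebble_move_move/fstep.
by rewrite -ltn_subRL.
Qed.

Lemma edge_rank_coloring_setT k c :
  edge_rank_coloring (restrict g setT) k c -> edge_rank_coloring g k c.
Proof.
have E x y : restrict g setT x y = g x y by rewrite /restrict [LHS]/= !in_setT !andbT.
have Eg d : (d \in edges (restrict g setT)) = (d \in edges g).
  by apply/edgesP/edgesP=> -[x [y [hxy ->]]]; exists x, y; rewrite E in hxy *.
case=> cr cs; split=> [d|a b] ; rewrite -!Eg; first exact: cr.
move=> aS bS nab cab t [x [p [hp up Ep]]]; apply: (cs a b aS bS nab cab).
by exists x, p; split=> //; rewrite (eq_path E).
Qed.

Lemma rev_number_erank : rev_number e r = erank g + 1.
Proof.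
have [ec _] : (exists c, edge_rank_coloring g (erank g) c) /\ _ :=
  minimumP (edge_rank_coloring_exists g).
have [c [c_range c_rank]] := ec.
have low : cut_rank (erank g) setT r.
  apply: (coloring_cut_rank _ c_rank (rooted_setT)) => [d /c_range/andP[] //|x y _ _ exy].
  have /c_range/andP[] // : [set x; y] \in edges g.
  by apply/edgesP; exists x, y; split=> //; apply: edge_underlying.
have [Ps pPs uPs] := reach_pebbling (cut_rank_reach rooted_setT low).
(* As [minimum] defaults to 0, a pebbling must be exhibited first; the one from the upper bound
   serves. *)
have ex_rev : exists n, exists2 Qs, persistent_pebbling e r Qs & pebbles_used Qs = n.
  by exists (pebbles_used Ps), Ps.
have [[Qs pQs uQs] rev_min] := minimumP ex_rev; rewrite -/(rev_number e r) in uQs rev_min.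
apply/eqP; rewrite addn1 eqn_leq; apply/andP; split.
  by apply: leq_trans uPs; apply: rev_min; exists Ps.
have rev_gt0 : 0 < rev_number e r.
  rewrite -uQs; apply: (@leq_trans #|[set r]|); first by rewrite cards1.
  have [_ <-] := pQs; apply: (@leq_bigmax_seq _ _ xpredT (fun P : {set V} => #|P|)) => //.
  exact: mem_last.
case Er: (rev_number e r) rev_gt0 => [//|k] _; rewrite ltnS.
have /(clearable_cut_rank rooted_setT)/(cut_rank_coloring rooted_setT)[c' c'P] : clearable setT r k.
  by apply: pebbling_clearable pQs _; rewrite uQs Er.
have [_] : (exists c, edge_rank_coloring g (erank g) c) /\ _ :=
  minimumP (edge_rank_coloring_exists g).
by apply; exists c'; apply: edge_rank_coloring_setT.
Qed.
End Tree.

Theorem mainTheorem1 (V : finType) (e : rel V) (r : V)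
  (hT : rooted_directed_tree e r) :
  rev_number e r = erank (underlying e) + 1.
Proof. exact: rev_number_erank. Qed.
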